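(* Let $N\geq 3$ be an integer and let $p\in (p_{sg},p_{JL})$. Let $u=u(x,t)$ be a real-valued classical solution of $$u_t=\Delta u+|u|^{p-1}u,\qquad x\in\mathbb{R}^N,\ t\leq 0,$$ such that $$|u(x,t)|\leq \varphi_\infty(x)\qquad \text{for all } x\in \mathbb{R}^N\setminus\{0\},\ t\leq 0.$$ Then $u\equiv 0$ on $\mathbb{R}^N\times(-\infty,0]$.
   Context: For $N\ge 3$, the Serrin exponent is $p_{sg}=\frac{N}{N-2}$, and the Joseph--Lundgren exponent is $$p_{JL}=\begin{cases}\dfrac{(N-2)^2-4N+8\sqrt{N-1}}{(N-2)(N-10)} & \text{if } N>10,\\[2mm] \infty & \text{if } N\leq 10.\end{cases}$$ For $p>p_{sg}$, the radial singular steady state is $$\varphi_\infty(x)=L|x|^{-2/(p-1)},\qquad L=\left(\frac{2}{p-1}\left(N-2-\frac{2}{p-1}\right)\right)^{1/(p-1)},\qquad x\in\mathbb{R}^N\setminus\{0\}.$$ The Laplacian $\Delta$ acts in the variable $x$. A classical solution on $\mathbb{R}^N\times(-\infty,0]$ is a function $u$ such that $u$, $u_t$ and the first and second order partial derivatives of $u$ in $x$ exist and are continuous on $\mathbb{R}^N\times(-\infty,0]$ (with $u_t$ one-sided at $t=0$), and which satisfies the equation pointwise. *)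

(* Defs.v *)
From HB Require Import structures.
From mathcomp Require Import all_boot all_order all_algebra.
From mathcomp Require Import all_classical all_reals all_analysis.

Set Implicit Arguments.
Unset Strict Implicit.
Unset Printing Implicit Defensive.

Import Order.TTheory GRing.Theory Num.Theory.
Import numFieldNormedType.Exports.

Local Open Scope classical_set_scope.
Local Open Scope ring_scope.

(* The library norm on row vectors is the sup norm, hence this definition. *)
Definition enorm (R : realType) (N : nat) (x : 'rV[R]_N) : R :=
  Num.sqrt (\sum_(i < N) x ord0 i ^+ 2).

Definition serrin_exponent (R : realType) (N : nat) : R := N%:R / (N%:R - 2).

Definition joseph_lundgren_exponent (R : realType) (N : nat) : \bar R :=
  if (10 < N)%N then
    (((N%:R - 2) ^+ 2 - 4 * N%:R + 8 * Num.sqrt (N%:R - 1))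
       / ((N%:R - 2) * (N%:R - 10)))%:E
  else +oo%E.

Definition sing_coef (R : realType) (N : nat) (p : R) : R :=
  (2 / (p - 1) * (N%:R - 2 - 2 / (p - 1))) `^ (1 / (p - 1)).

Definition phi_infty (R : realType) (N : nat) (p : R) (x : 'rV[R]_N) : R :=
  sing_coef N p * enorm x `^ (- (2 / (p - 1))).

Section ancient_functions.
Context {R : realType} {N : nat}.
Implicit Types u : 'rV[R]_N -> R -> R.

(* Functions on R^N x (-oo, 0] are represented by total functions
   u : 'rV[R]_N -> R -> R whose values at t > 0 are irrelevant: the time
   increments h below satisfy t + h <= 0, so that the derivative is two-sided
   for t < 0 and the left derivative at t = 0. *)
Definition time_quotient u (x : 'rV[R]_N) (t : R) : set_system R :=
  h^-1 * (u x (t + h) - u x t) @[h --> within [set h | t + h <= 0] 0^'].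

Definition time_derivable u x t : Prop := cvg (time_quotient u x t).

Definition dt u x t : R := lim (time_quotient u x t).

Definition dx (i : 'I_N) u : 'rV[R]_N -> R -> R :=
  fun x t => 'D_(delta_mx ord0 i) (u ^~ t) x.

Definition dx_derivable (i : 'I_N) u x t : Prop :=
  derivable (u ^~ t) x (delta_mx ord0 i).

Definition laplacian u x t : R := \sum_(i < N) dx i (dx i u) x t.

Definition ancient_continuous u : Prop :=
  {within [set z : 'rV[R]_N * R | z.2 <= 0],
    continuous (fun z : 'rV[R]_N * R => u z.1 z.2)}.

Record classical_regularity u : Prop := ClassicalRegularity {
  cr_u : ancient_continuous u;
  cr_dt_ex : forall x t, t <= 0 -> time_derivable u x t;
  cr_dt : ancient_continuous (dt u);
  cr_dx_ex : forall i x t, t <= 0 -> dx_derivable i u x t;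
  cr_dx : forall i, ancient_continuous (dx i u);
  cr_dxx_ex : forall i j x t, t <= 0 -> dx_derivable j (dx i u) x t;
  cr_dxx : forall i j, ancient_continuous (dx j (dx i u)) }.

Definition classical_solution (p : R) u : Prop :=
  classical_regularity u /\
  forall x t, t <= 0 ->
    dt u x t = laplacian u x t + `|u x t| `^ (p - 1) * u x t.

End ancient_functions.

(* Main.v *)
Require Import Defs.
From HB Require Import structures.
From mathcomp Require Import all_boot all_order all_algebra.
From mathcomp Require Import all_classical all_reals all_analysis.
From mathcomp Require Import ring lra.
Import Order.TTheory GRing.Theory Num.Theory.
Import numFieldNormedType.Exports.
Local Open Scope classical_set_scope.
Local Open Scope ring_scope.

(** Write c = 1 / (p - 1) and q = |x|^2.  It suffices to prove u <= 0, since -u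
    satisfies the same hypotheses.  For this, u is compared on paraboloids with
    the forward self-similar functions

      U (x, t) = B^(-c) G (|x|^2 / B),   B = e (t - t0),   |x|^2 <= Q B,

    started at an arbitrary time t0 < t.  If G is a bounded strict
    supersolution profile on [0, Q[ with L Q^(-c) < G Q, then u < U: on the
    lateral boundary because u <= phi_infty < U there; near the vertex (0, t0)
    because u is bounded there whereas U blows up; and inside because at a
    first contact point the two sides of the equation contradict each other.
    No uniform bound on u near x = 0 is needed, and the comparison takes place
    on a compact set.  As t0 -> -oo, the bound U (x, t) = O (B^(-c)) tends to 0,
    hence u <= 0.

    It remains to find G, which is where the restriction on p enters.  With
    e = 0, the requirement is a positive bounded radial function f with
    Delta f + f^p < 0 that overtakes phi_infty at a finite radius; since the
    inequality is strict on a compact range, a small e > 0 is then harmless.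
    Near the origin one takes f = L (1 + q)^(-c), an explicit
    supersolution which stays below phi_infty.  Far from the origin it is so
    close to phi_infty that the linearization at phi_infty governs the problem:
    one continues with f = L q^(-c) (1 - w (ln q)), where w is small and solves
    a linear equation with constant coefficients.  Its damping is taken larger
    than that of the linearization: this makes the inequality strict by a
    multiple of -w' > 0, which absorbs the nonlinear error o (w) as well as the
    term with e.  The condition p < p_JL says that the linearization oscillates
    whenever its damping is nonnegative, so that a larger damping can be chosen
    for which solutions still oscillate; then w changes sign and f crosses
    phi_infty.  The two pieces are joined at a point where the graph of
    f has a concave corner, so that the inner piece, which is nowhere below f
    near that point, is an admissible test function there.

    The comparison is in [comparison] and [nonpos_of_profile], the
    construction of G in [exists_profile]. *)

Set Implicit Arguments.
Unset Strict Implicit.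

(** * One-sided and second order conditions at a contact point *)

Lemma is_derive_cvg_quotient (R : numFieldType) (V W : normedModType R)
    (f : V -> W) (x v : V) (d : W) :
  is_derive x v f d ->
  h^-1 *: (f (h *: v + x) - f x) @[h --> 0^'] --> d.
Proof. by case=> fd <-; exact: fd. Qed.

Lemma local_max_derive2_le0 (R : realType) (f f' : R -> R) (a d : R) :
  (\forall x \near a, is_derive (x : R) 1 f (f' x)) ->
  is_derive (a : R) 1 f' d ->
  (\forall x \near a, f x <= f a) -> d <= 0.
Proof.
move=> df /is_derive_cvg_quotient df' fmax.
rewrite leNgt; apply/negP => d_gt0.
have [r /= r_gt0 ar] :
    \forall x \near a, is_derive (x : R) 1 f (f' x) /\ f x <= f a.
  by apply: filterS2 df fmax => x.
have inar x : x \in `]a - r, a + r[ ->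
    is_derive (x : R) 1 f (f' x) /\ f x <= f a.
  by rewrite in_itv/= => xr; apply: ar; rewrite /= distrC ltr_distl.
have ain : a \in `]a - r, a + r[ by rewrite in_itv/= ltrBlDr !ltrDl r_gt0.
have f'a0 : f' a = 0.
  have le_ar : a - r <= a + r by rewrite lerD2l ge0_cp// ltW.
  have [_ <-] := (inar a ain).1.
  have [_ ->//] := derive1_at_max le_ar
    (fun x hx => @ex_derive _ _ _ _ _ _ _ (inar x hx).1) ain
    (fun x hx => (inar x hx).2).
have [s /= s_gt0 as_] :
    \forall h \near 0^', 0 < h^-1 *: (f' (h *: (1 : R) + a) - f' a).
  by apply: (cvgr_gt d).
pose b := a + Num.min r s / 2.
have rs_gt0 : 0 < Num.min r s by rewrite lt_min r_gt0.
have ab : a < b by rewrite ltrDl divr_gt0.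
have abr x : x \in `[a, b] -> x \in `]a - r, a + r[.
  rewrite !in_itv/= => /andP[ax xb]; apply/andP; split; first lra.
  have : Num.min r s <= r by rewrite ge_min lexx.
  by move: xb; rewrite /b; lra.
have [x /[dup] xab|x|c cab] := @MVT _ f f' a b ab.
- rewrite in_itv/= => /andP[ax xb].
  by apply: (inar x _).1; apply: abr; rewrite in_itv/= !ltW.
- apply: derivable_within_continuous => y /abr /inar[? _].
  exact: ex_derive.
move: cab; rewrite in_itv/= => /andP[ac cb].
have /(_ _ _)/wrap[] := as_ (c - a).
- rewrite /= sub0r normrN gtr0_norm ?subr_gt0//.
  have : Num.min r s <= s by rewrite ge_min lexx orbT.
  by move: cb; rewrite /b; lra.
- by rewrite subr_eq0 gt_eqF.
rewrite [X in f' X](_ : _ = c); last by rewrite /GRing.scale/= mulr1 subrK.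
rewrite f'a0 subr0 /GRing.scale/= pmulr_rgt0 ?invr_gt0 ?subr_gt0// => f'c fba.
have := (inar b (abr b _)).2; rewrite in_itv/= lexx (ltW ab) => /(_ isT).
by rewrite leNgt -subr_gt0 fba mulr_gt0// subr_gt0.
Qed.

(** The time condition at a first contact point: only a left derivative of f is
    available when t = 0. *)
Lemma left_quotient_ge (R : realType) (f g : R -> R) (t a b : R) : t <= 0 ->
  h^-1 * (f (t + h) - f t) @[h --> within [set h | t + h <= 0] 0^'] --> a ->
  is_derive (t : R) 1 g b -> f t = g t ->
  (\forall s \near t^'-, f s <= g s) -> b <= a.
Proof.
move=> t_le0 fa /is_derive_cvg_quotient gb fgt fg.
have fa' : h^-1 * (f (t + h) - f t) @[h --> 0^'-] --> a.
  apply: cvg_trans fa; apply: cvg_app => A /=.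
  rewrite /within/= => -[e /= e_gt0 eA]; exists e => //= h he h_lt0.
  by apply: (eA h he); [rewrite lt_eqF|rewrite /=; lra].
have gb' : h^-1 *: (g (h *: (1 : R) + t) - g t) @[h --> 0^'-] --> b.
  apply: cvg_trans gb; apply: cvg_app => A /= [e /= e_gt0 eA].
  by exists e => //= h he h_lt0; apply: (eA h he); rewrite lt_eqF.
apply: ler_cvg_to gb' fa' _.
move: fg => [e /= e_gt0 ft].
exists e => //= h; rewrite /ball_/= sub0r normrN => he h_lt0.
have -> : h *: (1 : R) + t = t + h by rewrite /GRing.scale/= mulr1 addrC.
rewrite fgt; apply: ler_wnM2l; first by rewrite invr_le0 ltW.
apply: lerB => //; apply: ft; last lra.
by rewrite /ball_/= (_ : t - (t + h) = - h) ?normrN//; ring.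
Qed.

(** * Radial test functions *)

(** Profiles are taken as functions of |x|^2 rather than |x|: they are then
    smooth across the origin and no singular term (N - 1) / r appears. *)
Definition sqnorm (R : realType) (N : nat) (x : 'rV[R]_N) : R :=
  \sum_(i < N) x ord0 i ^+ 2.

Lemma sqnorm_ge0 (R : realType) (N : nat) (x : 'rV[R]_N) : 0 <= sqnorm x.
Proof. by apply: sumr_ge0 => i _; exact: sqr_ge0. Qed.

Lemma coord_le_sqnorm (R : realType) (N : nat) (x : 'rV[R]_N) i :
  x ord0 i ^+ 2 <= sqnorm x.
Proof.
rewrite /sqnorm (bigD1 i)//= lerDl.
by apply: sumr_ge0 => j _; exact: sqr_ge0.
Qed.

Lemma sqnorm_line (R : realType) (N : nat) (x : 'rV[R]_N) i (h : R) :
  sqnorm (h *: delta_mx ord0 i + x) =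
  sqnorm x + (2 * x ord0 i * h + h ^+ 2).
Proof.
rewrite /sqnorm (bigD1 i)//= [in RHS](bigD1 i)//= !mxE eqxx.
under eq_bigr => j ji do rewrite !mxE eqxx/= (negbTE ji) mulr0 add0r.

rewrite eqxx mulr1.
ring.
Qed.

Lemma sqnorm_continuous (R : realType) (N : nat) :
  continuous (@sqnorm R N).
Proof.
apply: continuous_big; first exact: add_continuous.
move=> i _ x; have c := @coord_continuous R 1 N ord0 i x.
by rewrite /continuous_at; exact: (cvgM c c).
Qed.

Lemma is_derive_line (R : realType) (N : nat) (w : 'rV[R]_N -> R)
    (x e : 'rV[R]_N) (h d : R) :
  is_derive (h *: e + x) e w d ->
  is_derive (h : R) 1 (fun k => w (k *: e + x)) d.
Proof.
move=> wd.
have cvgd : h0^-1 *: (((fun k => w (k *: e + x)) \o shift h) (h0 *: (1 : R)) -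
    w (h *: e + x)) @[h0 --> 0^'] --> d.
  under eq_cvg => k do rewrite /= [k *: (1 : R)]mulr1 scalerDl -addrA.
  exact: is_derive_cvg_quotient.
split; first by apply/cvg_ex; exists d.
exact: cvg_lim cvgd.
Qed.

(** The right-hand side is the Laplacian of y |-> K g (|y|^2 / B) at x.  The
    inequality holds coordinate by coordinate, from the second order condition
    for the maximum at 0 of h |-> w (h e_i + x) - K g (|h e_i + x|^2 / B). *)
Lemma laplacian_le_of_touch (R : realType) (N : nat) (w : 'rV[R]_N -> R)
    (wx : 'I_N -> 'rV[R]_N -> R) (wxx : 'I_N -> R) (x : 'rV[R]_N)
    (K B d2 : R) (g d1 : R -> R) :
  (forall i y, is_derive (y : 'rV[R]_N) (delta_mx ord0 i) w (wx i y)) ->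
  (forall i, is_derive (x : 'rV[R]_N) (delta_mx ord0 i) (wx i) (wxx i)) ->
  (\forall q \near sqnorm x / B, is_derive (q : R) 1 g (d1 q)) ->
  is_derive (sqnorm x / B : R) 1 d1 d2 ->
  w x = K * g (sqnorm x / B) ->
  (\forall y \near x, w y <= K * g (sqnorm y / B)) ->
  \sum_(i < N) wxx i <=
    K / B * (4 * (sqnorm x / B) * d2 + 2 * N%:R * d1 (sqnorm x / B)).
Proof.
move=> dw ddw dg ddg wxE wle.
set q := sqnorm x / B in dg ddg wxE *.
have coord i : wxx i <= K / B * (4 * (x ord0 i ^+ 2 / B) * d2 + 2 * d1 q).
  set e : 'rV[R]_N := delta_mx ord0 i.
  pose P (h : R) := B^-1 * (sqnorm x + (2 * x ord0 i * h + h ^+ 2)).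
  pose P' (h : R) := B^-1 * (2 * x ord0 i + 2 * h).
  have P0 : P 0 = q by rewrite /P /q; ring.
  have dP (h : R) : is_derive (h : R) 1 P (P' h).
    apply: is_derive_eq; rewrite /P' /GRing.scale/=; ring.
  have ddP (h : R) : is_derive (h : R) 1 P' (B^-1 * 2).
    apply: is_derive_eq; rewrite /GRing.scale/=; ring.
  have cP : P h @[h --> (0 : R)] --> q.
    have : {for 0, continuous P}; last by rewrite -P0.
    by apply/differentiable_continuous/derivable1_diffP.
  pose f (h : R) := w (h *: e + x) - K * g (P h).
  pose f' (h : R) := wx i (h *: e + x) - K * (d1 (P h) * P' h).
  have df : \forall h \near (0 : R), is_derive (h : R) 1 f (f' h).
    have : \forall h \near (0 : R), is_derive (P h : R) 1 g (d1 (P h)).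
      exact: (cP _ dg).
    apply: filterS => h dgh.
    apply: is_deriveB; first exact: is_derive_line.
  have ddf : is_derive (0 : R) 1 f' (wxx i -
      K * (d2 * P' 0 * P' 0 + d1 q * (B^-1 * 2))).
    apply: is_deriveB.
      by apply: is_derive_line; rewrite scale0r add0r; exact: ddw.
    rewrite -P0 in ddg.
    have dd1 := @is_derive1_comp _ d1 P 0 _ _ ddg (dP 0).
    have := is_deriveZ K (is_deriveM dd1 (ddP 0)).
    move=> /is_derive_eq; apply.
    by rewrite /GRing.scale/= P0; ring.
  have fmax : \forall h \near (0 : R), f h <= f 0.
    have cx : (h *: e + x) @[h --> (0 : R)] --> x.
      have e0x : 0 *: e + x = x by rewrite scale0r add0r.
      rewrite -[X in _ --> X]e0x.
      by apply: cvgD; [apply: cvgZr_tmp; exact: cvg_id|exact: cvg_cst].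
    have : \forall h \near (0 : R),
        w (h *: e + x) <= K * g (sqnorm (h *: e + x) / B) by exact: (cx _ wle).
    apply: filterS => h.
    rewrite /f scale0r add0r wxE P0 subrr subr_le0.
    by rewrite sqnorm_line /P [B^-1 * _]mulrC.
  have := local_max_derive2_le0 df ddf fmax.
  rewrite subr_le0 => /le_trans; apply.
  rewrite /P' le_eqVlt; apply/orP; left; apply/eqP; ring.
apply: le_trans (ler_sum _ (fun i _ => coord i)) _.
rewrite -mulr_sumr big_split/= sumr_const card_ord -mulr_suml -mulr_sumr.
rewrite -mulr_suml -/(sqnorm x) -/q.
by rewrite -mulr_natr le_eqVlt; apply/orP; left; apply/eqP; ring.
Qed.

(** * Self-similar barriers *)

(** The consequences of being a classical solution that the comparison uses,
    with the derivatives as data; this form is visibly stable under u |-> -u.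
    Clamping time at 0 turns continuity on t <= 0 into global continuity. *)
Record ancient_solution (R : realType) (N : nat) (p : R)
    (u ut : 'rV[R]_N -> R -> R) (ux uxx : 'I_N -> 'rV[R]_N -> R -> R) : Prop :=
  AncientSolution {
  anc_continuous :
    continuous (fun z : 'rV[R]_N * R => u z.1 (Num.min z.2 0));
  anc_dt : forall x t, t <= 0 ->
    h^-1 * (u x (t + h) - u x t) @[h --> within [set h | t + h <= 0] 0^']
      --> ut x t;
  anc_dx : forall i x t, t <= 0 ->
    is_derive (x : 'rV[R]_N) (delta_mx ord0 i) (u ^~ t) (ux i x t);
  anc_dxx : forall i x t, t <= 0 ->
    is_derive (x : 'rV[R]_N) (delta_mx ord0 i) (ux i ^~ t) (uxx i x t);
  anc_eq : forall x t, t <= 0 ->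
    ut x t = \sum_(i < N) uxx i x t + `|u x t| `^ (p - 1) * u x t }.

Arguments anc_continuous {R N p u ut ux uxx} _ _.
Arguments anc_dt {R N p u ut ux uxx} _ x t _.
Arguments anc_dx {R N p u ut ux uxx} _ i x t _.
Arguments anc_dxx {R N p u ut ux uxx} _ i x t _.
Arguments anc_eq {R N p u ut ux uxx} _ x t _.

(** Up to the factor B^(-c-1), the inequality says that the self-similar function
    with profile g is a strict supersolution where |x|^2 / B = q: the first two
    terms are the Laplacian, the last one is minus the time derivative. *)
Definition strict_supersolution_at (R : realType) (N : nat) (p e : R)
    (g : R -> R) (q : R) : Prop :=
  exists (d1 : R -> R) (d2 : R), [/\
    \forall r \near q, is_derive (r : R) 1 g (d1 r),
    is_derive (q : R) 1 d1 d2 &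
    4 * q * d2 + 2 * N%:R * d1 q + g q `^ p + e * (g q / (p - 1) + q * d1 q)
      < 0].

(** G need not be differentiable at q: it is enough that a smooth strict
    supersolution touches it from above there, as for a minimum of smooth
    supersolutions. *)
Definition strict_profile_at (R : realType) (N : nat) (p e : R) (G : R -> R)
    (q : R) : Prop :=
  exists g : R -> R, [/\ g q = G q,
    \forall r \near q, 0 <= r -> G r <= g r &
    strict_supersolution_at N p e g q].

Definition self_similar (R : realType) (N : nat) (p e t0 : R) (G : R -> R)
    (x : 'rV[R]_N) (t : R) : R :=
  (e * (t - t0)) `^ (- (p - 1)^-1) * G (sqnorm x / (e * (t - t0))).

Lemma powR_subr1 (R : realType) (x r : R) :
  0 < x -> x `^ (r - 1) = x `^ r / x.
Proof.
by move=> x_gt0; rewrite powRB ?powRr1 ?(ltW x_gt0)// (lt0r_neq0 x_gt0) implybT.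
Qed.

Lemma is_derive_self_similar (R : realType) (p e t0 S t d : R) (g : R -> R) :
  0 < e -> t0 < t -> is_derive (S / (e * (t - t0)) : R) 1 g d ->
  is_derive (t : R) 1
    (fun s => (e * (s - t0)) `^ (- (p - 1)^-1) * g (S / (e * (s - t0))))
    (- (e * ((e * (t - t0)) `^ (- (p - 1)^-1) / (e * (t - t0))) *
      (g (S / (e * (t - t0))) / (p - 1) + S / (e * (t - t0)) * d))).
Proof.
move=> e_gt0 t0t dg.
pose B (s : R) := e * (s - t0).
have B_gt0 : 0 < B t by rewrite mulr_gt0 ?subr_gt0.
have dB (s : R) : is_derive (s : R) 1 B e.
  by apply: is_derive_eq; rewrite /GRing.scale/=; ring.
have dpow := @is_derive1_comp _ (@powR R ^~ (- (p - 1)^-1)) B t _ _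
  (is_derive1_powR (- (p - 1)^-1) B_gt0) (dB t).
have dV : is_derive (t : R) 1 (fun s => S * (B s)^-1) (- (S / B t / B t * e)).
  have := is_deriveV (lt0r_neq0 B_gt0) (dB t).
  move=> /(is_deriveZ S) /is_derive_eq; apply.
  rewrite /GRing.scale/=; field; exact: lt0r_neq0.
have dgV := @is_derive1_comp _ g (fun s => S * (B s)^-1) t _ _ dg dV.
have := is_deriveM dpow dgV => /is_derive_eq; apply.
rewrite powR_subr1// /GRing.scale/= -/(B t).
set c := (p - 1)^-1; set b := B t in B_gt0 *.
by field; rewrite lt0r_neq0.
Qed.

(** At a contact point from below, u_t is at least U_t, Delta u at most Delta U
    and the nonlinear terms agree, so the equation for u contradicts the strict
    inequality for U. *)
Lemma no_contact (R : realType) (N : nat) (p e t0 : R) (u ut : 'rV[R]_N -> R -> R)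
    (ux uxx : 'I_N -> 'rV[R]_N -> R -> R) (G : R -> R) (x : 'rV[R]_N) (t : R) :
  ancient_solution p u ut ux uxx ->
  1 < p -> 0 < e -> t0 < t -> t <= 0 ->
  0 < G (sqnorm x / (e * (t - t0))) ->
  strict_profile_at N p e G (sqnorm x / (e * (t - t0))) ->
  u x t = self_similar p e t0 G x t ->
  (\forall y \near x, u y t <= self_similar p e t0 G y t) ->
  (\forall s \near t^'-, u x s <= self_similar p e t0 G x s) ->
  False.
Proof.
move=> us p_gt1 e_gt0 t0t t_le0.
set B := e * (t - t0); set q := sqnorm x / B => Gq_gt0.
move=> [g [gq Gg [d1 [d2 [dg ddg super]]]]] uE ux_le ut_le.
rewrite gq in super.
have B_gt0 (s : R) : t0 < s -> 0 < e * (s - t0).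
  by move=> t0s; rewrite mulr_gt0 ?subr_gt0.
have q_ge0 (y : 'rV[R]_N) (s : R) : t0 < s -> 0 <= sqnorm y / (e * (s - t0)).
  by move=> t0s; rewrite divr_ge0 ?sqnorm_ge0// ltW// B_gt0.
have Bt := B_gt0 t t0t; rewrite -/B in Bt.
set K := B `^ (- (p - 1)^-1).
have K_gt0 : 0 < K by exact: powR_gt0.
have lap : \sum_(i < N) uxx i x t <=
    K / B * (4 * q * d2 + 2 * N%:R * d1 q).
  apply: (laplacian_le_of_touch (w := u ^~ t) (wx := fun i => ux i ^~ t)
    (g := g)) => //.
  - by move=> i y; exact: (anc_dx us i y t).
  - by move=> i; exact: (anc_dxx us i x t).
  - by rewrite uE /self_similar -/B -/q gq.
  - have cq : (sqnorm y / B) @[y --> x] --> q.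
      by have sc := @sqnorm_continuous R N x; exact: cvgMl sc.
    have near_g : \forall y \near x, 0 <= sqnorm y / B ->
        G (sqnorm y / B) <= g (sqnorm y / B) by exact: (cq _ Gg).
    apply: filterS2 ux_le near_g => y uy /(_ (q_ge0 y t t0t)) Ggy.
    by apply: le_trans uy _; rewrite /self_similar ler_wpM2l// ltW.
have time : - (e * (K / B) * (g q / (p - 1) + q * d1 q)) <= ut x t.
  have dU := is_derive_self_similar p e_gt0 t0t (nbhs_singleton dg).
  apply: (left_quotient_ge (f := u x) t_le0 (anc_dt us x t t_le0) dU).
  - by rewrite uE /self_similar -/B -/q gq.
  - have cq : (sqnorm x / (e * (s - t0))) @[s --> t] --> q.
      apply: cvgM; first exact: cvg_cst.
      apply: cvgV; first exact: lt0r_neq0.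
      by apply: cvgM; [exact: cvg_cst|apply: cvgB; [exact: cvg_id|exact: cvg_cst]].
    have near_g : \forall s \near t^'-, 0 <= sqnorm x / (e * (s - t0)) ->
        G (sqnorm x / (e * (s - t0))) <= g (sqnorm x / (e * (s - t0))).
      by apply: cvg_within; exact: (cq _ Gg).
    have near_t0 : \forall s \near t^'-, t0 < s by exact: nbhs_left_gt.
    apply: filterS3 ut_le near_g near_t0 => s us_le Gs t0s.
    apply: le_trans us_le _; rewrite /self_similar ler_wpM2l//.
    - exact: powR_ge0.
    - exact: Gs (q_ge0 x s t0s).
have p1_gt0 : 0 < p - 1 by rewrite subr_gt0.
have nonlin : `|u x t| `^ (p - 1) * u x t = K / B * G q `^ p.
  have u_gt0 : 0 < u x t by rewrite uE mulr_gt0.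
  rewrite gtr0_norm// mulrC mulr_powRB1 ?(ltW u_gt0)//; last first.
    exact: lt_trans p_gt1.
  rewrite uE /self_similar -/B -/q -/K powRM ?ltW//; congr (_ * _).
  rewrite /K -powRrM -powR_subr1//; congr (_ `^ _).
  by field; exact: lt0r_neq0.
have := anc_eq us x t t_le0; rewrite nonlin => eqn.
have KB_gt0 : 0 < K / B by rewrite divr_gt0.
have : 0 <= K / B *
    (4 * q * d2 + 2 * N%:R * d1 q + G q `^ p + e * (G q / (p - 1) + q * d1 q)).
  rewrite -gq.
  have -> : K / B * (4 * q * d2 + 2 * N%:R * d1 q + g q `^ p +
      e * (g q / (p - 1) + q * d1 q)) =
    K / B * (4 * q * d2 + 2 * N%:R * d1 q) + K / B * g q `^ p +
      e * (K / B) * (g q / (p - 1) + q * d1 q) by ring.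
  by rewrite gq in time eqn *; lra.
by rewrite pmulr_rge0// leNgt super.
Qed.

(** * Comparison on a paraboloid *)

(** U is at least mu B^(-c), which tends to +oo as t -> t0, whereas u stays
    bounded near (0, t0); the slice of the paraboloid at time t shrinks to the
    vertex. *)
Lemma self_similar_corner (R : realType) (N : nat) (p e t0 Q mu : R)
    (u ut : 'rV[R]_N -> R -> R) (ux uxx : 'I_N -> 'rV[R]_N -> R -> R)
    (G : R -> R) :
  ancient_solution p u ut ux uxx -> 1 < p -> 0 < e -> 0 < Q -> 0 < mu ->
  t0 < 0 -> (forall q : R, 0 <= q <= Q -> mu <= G q) ->
  exists2 s, 0 < s & forall x t, t0 < t -> t <= t0 + s -> t <= 0 ->
    sqnorm x <= Q * (e * (t - t0)) -> u x t < self_similar p e t0 G x t.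
Proof.
move=> us p_gt1 e_gt0 Q_gt0 mu_gt0 t0_lt0 muG.
have p1_gt0 : 0 < p - 1 by rewrite subr_gt0.
pose M : R := `|u 0 t0| + 1.
have M_gt0 : 0 < M by rewrite ltr_wpDl.
have [d /= d_gt0 uM] : exists2 d : R, 0 < d &
    forall z : 'rV[R]_N * R, ball (0 : 'rV[R]_N, t0) d z ->
      u z.1 (Num.min z.2 0) < M.
  apply/nbhs_ballP.
  have := anc_continuous us (0, t0).
  move=> /(cvgr_lt (u 0 (Num.min t0 0))); apply.
  by rewrite /= min_l ?ltW// /M (le_lt_trans (ler_norm _))// ltrDl.
(* The three bounds put t in the time range, and x in the ball, where u < M,
   and ensure that B^(-c) mu >= M. *)
pose s : R := Num.min (d / 2) (Num.min (d ^+ 2 / (2 * (Q * e)))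
  ((mu / M) `^ (p - 1) / e)).
have s_gt0 : 0 < s.
  rewrite /s !lt_min !divr_gt0 ?mulr_gt0 ?exprn_gt0//.
  by rewrite powR_gt0// divr_gt0.
exists s => // x t t0t ts t_le0 xQ.
have r_gt0 : 0 < t - t0 by rewrite subr_gt0.
have rs : t - t0 <= s by lra.
have B_gt0 : 0 < e * (t - t0) by rewrite mulr_gt0.
have rd : t - t0 < d.
  have : s <= d / 2 by rewrite ge_min lexx.
  lra.
have xd : sqnorm x < d ^+ 2.
  have s2 : s <= d ^+ 2 / (2 * (Q * e)) by rewrite !ge_min lexx orbT.
  apply: le_lt_trans xQ _.
  have : Q * (e * (t - t0)) <= Q * (e * (d ^+ 2 / (2 * (Q * e)))).
    by rewrite !ler_pM2l// (le_trans rs).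
  move=> /le_lt_trans; apply.
  have -> : Q * (e * (d ^+ 2 / (2 * (Q * e)))) = d ^+ 2 / 2.
    by field; rewrite !lt0r_neq0.
  have : 0 < d ^+ 2 by rewrite exprn_gt0.
  lra.
have Br : e * (t - t0) <= (mu / M) `^ (p - 1).
  have s3 : s <= (mu / M) `^ (p - 1) / e by rewrite !ge_min lexx !orbT.
  by rewrite mulrC -ler_pdivlMr// (le_trans rs).
have uxt : u x t < M.
  have /= := uM (x, t); rewrite min_l//; apply; split => /=.
  - split=> // i j; rewrite !ord1 mxE /ball/= sub0r normrN.
    rewrite -(@ltr_pXn2r _ 2) ?nnegrE ?(ltW d_gt0)// real_normK ?num_real//.
    exact: le_lt_trans (coord_le_sqnorm x j) xd.
  - by rewrite /ball/= ltr_distlC; apply/andP; split; lra.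
apply: lt_le_trans uxt _.
have muGq : mu <= G (sqnorm x / (e * (t - t0))).
  by apply: muG; rewrite divr_ge0 ?sqnorm_ge0 ?(ltW B_gt0)//= ler_pdivrMr.
apply: le_trans (_ : M / mu * mu <= _); first by rewrite divfK// lt0r_neq0.
apply: ler_pM => //; [by rewrite divr_ge0 ?ltW|exact: ltW|].
rewrite powRN -invf_div lef_pV2 ?posrE ?powR_gt0 ?divr_gt0//.
have -> : mu / M = ((mu / M) `^ (p - 1)) `^ (p - 1)^-1.
  by rewrite -powRrM divff ?lt0r_neq0// powRr1// divr_ge0 ?ltW.
apply: ge0_ler_powR; rewrite ?nnegrE ?invr_ge0 ?powR_ge0//; exact: ltW.
Qed.

(** Otherwise the points of the paraboloid with u >= U form a compact set.  One
    with the smallest time is neither near the vertex nor on the lateral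
    boundary, and u < U before it: it is a contact point from below. *)
Lemma comparison (R : realType) (N : nat) (p e t0 Q mu : R)
    (u ut : 'rV[R]_N -> R -> R) (ux uxx : 'I_N -> 'rV[R]_N -> R -> R)
    (G : R -> R) :
  ancient_solution p u ut ux uxx -> 1 < p -> 0 < e -> 0 < Q -> 0 < mu ->
  t0 < 0 ->
  (forall q : R, 0 <= q -> {for q, continuous G}) ->
  (forall q : R, 0 <= q <= Q -> mu <= G q) ->
  (forall q : R, 0 <= q < Q -> strict_profile_at N p e G q) ->
  (forall x t, t0 < t -> t <= 0 -> sqnorm x = Q * (e * (t - t0)) ->
    u x t < self_similar p e t0 G x t) ->
  forall x t, t0 < t -> t <= 0 -> sqnorm x <= Q * (e * (t - t0)) ->
    u x t < self_similar p e t0 G x t.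
Proof.
move=> us p_gt1 e_gt0 Q_gt0 mu_gt0 t0_lt0 cG muG superG lateral x t t0t t_le0 xQ.
have [s s_gt0 corner] :=
  self_similar_corner us p_gt1 e_gt0 Q_gt0 mu_gt0 t0_lt0 muG.
rewrite ltNge; apply/negP => Uu.
(* Freezing the clamped time away from t0 makes the gap globally continuous. *)
pose B (z : 'rV[R]_N * R) := e * Num.max (z.2 - t0) s.
pose D (z : 'rV[R]_N * R) :=
  u z.1 (Num.min z.2 0) - B z `^ (- (p - 1)^-1) * G (sqnorm z.1 / B z).
have B_gt0 z : 0 < B z by rewrite mulr_gt0// lt_max s_gt0 orbT.
have DE y r : t0 + s <= r -> r <= 0 -> D (y, r) = u y r - self_similar p e t0 G y r.
  move=> sr r_le0; rewrite /D /B /self_similar/= min_l// max_l//; lra.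
have csnd : continuous (@snd 'rV[R]_N R) by move=> z; exact: cvg_snd.
have csq : continuous (fun z : 'rV[R]_N * R => sqnorm z.1).
  by move=> z; apply: (cvg_comp _ _ (@cvg_fst _ _ _ _ _)); exact: sqnorm_continuous.
have cB : continuous B.
  move=> z.
  have ct : {for z, continuous (fun y : 'rV[R]_N * R => y.2 - t0)}.
    by apply: cvgB; [exact: csnd|exact: cvg_cst].
  have cs : {for z, continuous (cst s : 'rV[R]_N * R -> R)} by exact: cvg_cst.
  exact: (cvgM (cvg_cst e) (continuous_max ct cs)).
have cD : continuous D.
  move=> z; apply: cvgB; first exact: (anc_continuous us z).
  apply: cvgM.
    have dpow := is_derive1_powR (- (p - 1)^-1) (B_gt0 z).
    have cpow : {for B z, continuous (fun r => r `^ (- (p - 1)^-1))}.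
      exact/differentiable_continuous/derivable1_diffP.
    exact: (continuous_comp (cB z) cpow).
  have cq : {for z, continuous (fun z => sqnorm z.1 / B z)}.
    by apply: cvgM; [exact: csq|apply: cvgV; [exact: lt0r_neq0|exact: cB]].
  have cGq : {for sqnorm z.1 / B z, continuous G}.
    by apply: cG; rewrite divr_ge0 ?sqnorm_ge0// ltW.
  exact: (continuous_comp cq cGq).
(* E <= 0 describes the paraboloid, and Z the points of it where u >= U. *)
pose E (z : 'rV[R]_N * R) := sqnorm z.1 - Q * (e * (z.2 - t0)).
have cE : continuous E.
  move=> z; apply: cvgB; first exact: csq.
  apply: cvgM; first exact: cvg_cst.
  apply: cvgM; first exact: cvg_cst.
  by apply: cvgB; [exact: csnd|exact: cvg_cst].
pose Z : set ('rV[R]_N * R) :=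
  (snd @^-1` `[t0 + s, t]) `&` (E @^-1` [set a | a <= 0])
    `&` (D @^-1` [set a | 0 <= a]).
have closedZ : closed Z.
  apply: closedI; first apply: closedI.
  - apply: closed_comp; [by move=> z _; exact: csnd|exact: interval_closed].
  - by apply: closed_comp; [move=> z _; exact: cE|exact: closed_le].
  - by apply: closed_comp; [move=> z _; exact: cD|exact: closed_ge].
have ts : t0 + s <= t.
  rewrite leNgt; apply/negP => tlt.
  by have := corner x t t0t (ltW tlt) t_le0 xQ; rewrite ltNge Uu.
pose b : R := 1 + Q * (e * (t - t0)).
have compactZ : compact Z.
  have compact_box : compact ([set v : 'rV[R]_N | forall i, v ord0 i \in `[- b, b]]
      `*` `[t0 + s, t]).
    apply: compact_setX; last exact: segment_compact.
    by apply: (@rV_compact R N (fun=> `[- b, b]%classic)) => _; exact: segment_compact.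
  apply: subclosed_compact closedZ compact_box _ => -[y r] [[/= rst Eyr] _].
  split => //= i.
  move: rst; rewrite !in_itv/= => /andP[sr rt].
  have yb : y ord0 i ^+ 2 <= Q * (e * (t - t0)).
    apply: le_trans (coord_le_sqnorm y i) _.
    move: Eyr; rewrite /E/= subr_le0 => /le_trans; apply.
    by rewrite !ler_pM2l// lerD2r.
  by rewrite /b; apply/andP; split; nra.
have Z0 : Z !=set0.
  exists (x, t); split; first split => /=.
  - by rewrite in_itv/= ts lexx.
  - by rewrite /E/= subr_le0.
  - by rewrite /= DE// subr_ge0.
have [[x1 t1]] := compact_EVT_min Z0 compactZ (continuous_subspaceT csnd).
rewrite inE => -[[/= + Ez] Dz] first_time.
rewrite in_itv/= => /andP[st1 t1t].
have t1_le0 : t1 <= 0 by exact: le_trans t_le0.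
have t0t1 : t0 < t1 by rewrite (lt_le_trans _ st1)// ltrDl.
have Uu1 : self_similar p e t0 G x1 t1 <= u x1 t1.
  by move: Dz; rewrite /= DE// subr_ge0.
have x1Q : sqnorm x1 <= Q * (e * (t1 - t0)) by move: Ez; rewrite /E subr_le0.
have {}st1 : t0 + s < t1.
  rewrite lt_neqAle st1 andbT; apply/eqP => st1E.
  have := corner x1 t1 t0t1; rewrite -st1E lexx st1E => /(_ isT t1_le0 x1Q).
  by rewrite ltNge Uu1.
have {}x1Q : sqnorm x1 < Q * (e * (t1 - t0)).
  rewrite lt_neqAle x1Q andbT; apply/eqP => x1E.
  by have := lateral x1 t1 t0t1 t1_le0 x1E; rewrite ltNge Uu1.
have [d /= d_gt0 near_neg] : exists2 d : R, 0 < d &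
    forall z : 'rV[R]_N * R, ball (x1, t1) d z ->
      t0 + s < z.2 /\ (z.2 < t1 -> D z < 0).
  apply/nbhs_ballP.
  have near_E : \forall z \near (x1, t1), E z < 0.
    by apply: (cvgr_lt (E (x1, t1)) (cE _)); rewrite /E/= subr_lt0.
  have near_s : \forall z \near (x1, t1), t0 + s < z.2.
    exact: (cvgr_gt _ (csnd (x1, t1)) _ st1).
  apply: filterS2 near_E near_s => z Ez0 sz; split => // zt1.
  rewrite ltNge; apply/negP => Dz0.
  have := first_time z; rewrite leNgt zt1 inE; case/(_ _)/notF.
  split; first split => /=; rewrite ?in_itv/= ?(ltW sz)//=.
  - exact: le_trans (ltW zt1) t1t.
  - exact: ltW.
(* At the contact time itself, u <= U near x1 by passing to the limit. *)
have near_le y : ball x1 d y -> D (y, t1) <= 0.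
  move=> x1y.
  have cDy : D (y, r) @[r --> t1^'-] --> D (y, t1).
    have cy : {for t1, continuous (fun r : R => (y, r))}.
      exact: (cvg_pair (cvg_cst y) cvg_id).
    exact: cvg_at_left_filter (continuous_comp cy (cD (y, t1))).
  apply: ler_cvg_to cDy (cvg_cst (0 : R)) _.
  exists d => //= r t1r rt1.
  by have [_ /(_ rt1)/ltW] := near_neg (y, r) (conj x1y t1r).
apply: (no_contact us p_gt1 e_gt0 t0t1 t1_le0 (G := G) (x := x1)).
- apply: lt_le_trans mu_gt0 _; apply: muG.
  have B1 : 0 < e * (t1 - t0) by rewrite mulr_gt0 ?subr_gt0.
  by rewrite divr_ge0 ?sqnorm_ge0 ?(ltW B1)//= ler_pdivrMr// ltW.
- apply: superG.
  have B1 : 0 < e * (t1 - t0) by rewrite mulr_gt0 ?subr_gt0.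
  by rewrite divr_ge0 ?sqnorm_ge0 ?(ltW B1)//= ltr_pdivrMr.
- apply/eqP; rewrite eq_le Uu1 andbT -subr_le0 -DE ?(ltW st1)//.
  by apply: near_le; exact: ballxx.
- apply/nbhs_ballP; exists d => //= y x1y.
  by rewrite -subr_le0 -DE ?(ltW st1)//; exact: near_le.
- exists d => //= r t1r rt1.
  have x1r : ball (x1, t1) d (x1, r) by split => //; exact: ballxx.
  have [sr /(_ rt1)/ltW] := near_neg _ x1r.
  by rewrite DE ?subr_le0// ?(ltW sr)//= (le_trans (ltW rt1)).
Qed.

(** If u (x, t) > 0, the choice of t0 with e (t - t0) = B places x inside the
    paraboloid and gives U (x, t) <= B^(-c) Ga <= u (x, t). *)
Lemma nonpos_of_profile (R : realType) (N : nat) (p e Q mu Ga L : R)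
    (u ut : 'rV[R]_N -> R -> R) (ux uxx : 'I_N -> 'rV[R]_N -> R -> R)
    (G : R -> R) :
  ancient_solution p u ut ux uxx -> 1 < p -> 0 < e -> 0 < Q -> 0 < mu ->
  (forall q : R, 0 <= q -> {for q, continuous G}) ->
  (forall q : R, 0 <= q <= Q -> mu <= G q <= Ga) ->
  (forall q : R, 0 <= q < Q -> strict_profile_at N p e G q) ->
  L * Q `^ (- (p - 1)^-1) < G Q ->
  (forall x t, x != 0 -> t <= 0 -> u x t <= L * sqnorm x `^ (- (p - 1)^-1)) ->
  forall x t, t <= 0 -> u x t <= 0.
Proof.
move=> us p_gt1 e_gt0 Q_gt0 mu_gt0 cG muG superG GQ u_le x t t_le0.
rewrite leNgt; apply/negP => u_gt0.
have p1_gt0 : 0 < p - 1 by rewrite subr_gt0.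
have Ga_gt0 : 0 < Ga.
  have /muG/andP[muG0 /(le_trans muG0)] : (0 : R) <= 0 <= Q by rewrite lexx ltW.
  exact: lt_le_trans.
pose B : R := sqnorm x / Q + (Ga / u x t) `^ (p - 1).
have pow_gt0 : 0 < (Ga / u x t) `^ (p - 1) by rewrite powR_gt0// divr_gt0.
have B_gt0 : 0 < B by rewrite ltr_wpDl// divr_ge0 ?sqnorm_ge0// ltW.
pose t0 : R := t - B / e.
have eB : e * (t - t0) = B by rewrite /t0 opprB addrCA subrr addr0 mulrC divfK ?gt_eqF.
have t0t : t0 < t by rewrite ltrBlDr ltrDl divr_gt0.
have lateral y s : t0 < s -> s <= 0 -> sqnorm y = Q * (e * (s - t0)) ->
    u y s < self_similar p e t0 G y s.
  move=> t0s s_le0 yQ.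
  have Bs_gt0 : 0 < e * (s - t0) by rewrite mulr_gt0 ?subr_gt0.
  have y_neq0 : y != 0.
    apply/eqP => y0; move: yQ; rewrite y0 /sqnorm big1; last first.
      by move=> i _; rewrite mxE expr0n.
    by move=> /eqP; rewrite lt_eqF// mulr_gt0.
  apply: le_lt_trans (u_le y s y_neq0 s_le0) _.
  rewrite /self_similar yQ mulfK ?gt_eqF// powRM ?ltW// mulrA mulrC.
  by rewrite ltr_pM2l// powR_gt0.
have xQ : sqnorm x <= Q * (e * (t - t0)).
  by rewrite eB /B mulrDr mulrCA divff ?gt_eqF// mulr1 lerDl mulr_ge0// ltW.
have muG' q : 0 <= q <= Q -> mu <= G q by move=> /muG/andP[].
have := comparison us p_gt1 e_gt0 Q_gt0 mu_gt0 (lt_le_trans t0t t_le0)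
  cG muG' superG lateral t0t t_le0 xQ.
rewrite /self_similar eB ltNge => /negP; apply.
have /muG/andP[_ GGa] : 0 <= sqnorm x / B <= Q.
  by rewrite divr_ge0 ?sqnorm_ge0 ?(ltW B_gt0)//= ler_pdivrMr// -eB.
apply: (@le_trans _ _ (u x t / Ga * Ga)); last by rewrite divfK ?gt_eqF.
have muq : 0 <= G (sqnorm x / B).
  apply: le_trans (ltW mu_gt0) (muG' _ _).
  by rewrite divr_ge0 ?sqnorm_ge0 ?(ltW B_gt0)//= ler_pdivrMr// -eB.
apply: ler_pM => //; first exact: powR_ge0.
rewrite powRN -invf_div lef_pV2 ?posrE ?powR_gt0 ?divr_gt0//.
have -> : Ga / u x t = ((Ga / u x t) `^ (p - 1)) `^ (p - 1)^-1.
  by rewrite -powRrM divff ?gt_eqF// powRr1// divr_ge0 ?ltW.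
apply: ge0_ler_powR; rewrite ?nnegrE ?invr_ge0 ?powR_ge0 ?(ltW p1_gt0) ?(ltW B_gt0)//.
by rewrite lerDr divr_ge0 ?sqnorm_ge0// ltW.
Qed.

(** * Ingredients of the profile *)

Lemma powR_expansion (R : realType) (r d : R) : 0 < d ->
  exists2 s : R, 0 < s & forall h : R, `|h| <= s ->
    `|(1 + h) `^ r - 1 - r * h| <= d * `|h|.
Proof.
move=> d_gt0.
have dpow : is_derive (1 : R) 1 (@powR R ^~ r) r.
  by apply: is_derive_eq (is_derive1_powR r ltr01) _; rewrite powR1 mulr1.
have := is_derive_cvg_quotient dpow => /cvgrPdist_le/(_ _ d_gt0)[e /= e_gt0 He].
exists (e / 2); first by rewrite divr_gt0.
move=> h he; have [->|h_neq0] := eqVneq h 0.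
  by rewrite addr0 powR1 subrr mulr0 subrr normr0 mulr0.
have he' : `|h| < e by lra.
have := He h; rewrite /ball_/= sub0r normrN => /(_ he' h_neq0).
have -> : h *: (1 : R) + 1 = 1 + h by rewrite /GRing.scale/= mulr1 addrC.
rewrite powR1 /GRing.scale/= => H.
have -> : (1 + h) `^ r - 1 - r * h = - (h * (r - h^-1 * ((1 + h) `^ r - 1))).
  by field.
by rewrite normrN normrM mulrC ler_pM2r ?normr_gt0.
Qed.

(** With x = 1 / q0, the number 1 - y is the relative distance between
    L (1 + q)^(-c) and L q^(-c) at q = q0.  The logarithmic derivative of this
    distance with respect to ln q0 tends to -1 as q0 -> oo; the last inequality
    says that it is below -1/2, the initial slope of [damped_oscillation], and
    produces the concave corner. *)
Lemma corner_inequality (R : realType) (c d : R) : 0 < c -> 0 < d ->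
  exists2 x : R, 0 < x & let y := (1 + x) `^ (- c) in
    [/\ 0 < y, 0 < 1 - y, 1 - y <= d & (1 - y) / 2 < c * y * (x / (1 + x))].
Proof.
move=> c_gt0 d_gt0.
have [s s_gt0 Hs] := powR_expansion c (divr_gt0 c_gt0 (ltr0Sn R 1)).
pose x : R := Num.min s (Num.min (1 / 4) (d / (2 * c))).
have x_gt0 : 0 < x by rewrite !lt_min s_gt0 !divr_gt0 ?mulr_gt0.
have x4 : x <= 1 / 4 by rewrite !ge_min lexx orbT.
have xd : 2 * c * x <= d.
  have : x <= d / (2 * c) by rewrite !ge_min lexx !orbT.
  by rewrite ler_pdivlMr ?mulr_gt0// mulrC.
have := Hs x; rewrite gtr0_norm// ge_min lexx => /(_ isT).
set z := (1 + x) `^ c => Hz.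
have z_le : z - 1 <= 3 / 2 * (c * x).
  by move: Hz; rewrite ler_norml => /andP[_]; lra.
have cx_gt0 : 0 < c * x by rewrite mulr_gt0.
have z_gt1 : 1 < z by move: Hz; rewrite ler_norml => /andP[+ _]; lra.
have z_gt0 : 0 < z by lra.
exists x => //=; rewrite powRN -/z.
have zV : 0 < z^-1 by rewrite invr_gt0.
have zz : z^-1 * z = 1 by rewrite mulVf ?gt_eqF.
have E : 1 - z^-1 = z^-1 * (z - 1) by rewrite mulrBr zz mulr1.
have zV1 : z^-1 < 1 by rewrite invf_lt1.
split => //; first lra.
- rewrite E; nra.
- rewrite E [c * _]mulrC -!mulrA ltr_pM2l// mulrA ltr_pdivlMr; last lra.
  by nra.
Qed.

(** The solution has an explicit form exp (- al s) (cos (ga s) - ka sin (ga s)).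
    At a positive critical point w'' would be negative, so w, which starts
    decreasing, cannot level off before its first zero, and w' is still negative
    there; m and M are then given by compactness of [0, s1]. *)
Lemma damped_oscillation (R : realType) (al ga : R) : 0 < ga ->
  exists (w w' w'' : R -> R) (s1 M m : R), [/\
    [/\ forall s : R, is_derive s 1 w (w' s),
        forall s : R, is_derive s 1 w' (w'' s),
        forall s, w'' s + 2 * al * w' s + (al ^+ 2 + ga ^+ 2) * w s = 0,
        w 0 = 1 & w' 0 = - (1 / 2)],
    0 < s1, w s1 < 0 , 0 < m & 0 < M /\
    forall s, 0 <= s <= s1 -> w' s <= - m /\ `|w s| <= M].
Proof.
move=> ga_gt0.
have ga_neq0 : ga != 0 by rewrite gt_eqF.
pose ka : R := (1 / 2 - al) / ga.
pose ka' : R := (2 * (al ^+ 2 + ga ^+ 2) - al) / ga.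
pose E (s : R) := expR (- al * s).
pose w (s : R) := E s * (cos (ga * s) - ka * sin (ga * s)).
pose w' (s : R) := E s * (- (1 / 2) * (cos (ga * s) + ka' * sin (ga * s))).
pose w'' (s : R) := E s * (- al * (- (1 / 2) * (cos (ga * s) + ka' * sin (ga * s)))
   - (1 / 2) * (ga * (ka' * cos (ga * s) - sin (ga * s)))).
have dE (s : R) : is_derive s 1 E (- al * E s).
  have dl : is_derive s 1 (fun s : R => - al * s) (- al).
    by apply: is_derive_eq; rewrite /GRing.scale/= mulr1.
  have := @is_derive1_comp _ expR (fun s : R => - al * s) s _ _
    (is_derive_expR _) dl.
  by move=> /is_derive_eq; apply; rewrite mulrC.
have dl (s : R) : is_derive s 1 (fun s : R => ga * s) ga.
  by apply: is_derive_eq; rewrite /GRing.scale/= mulr1.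
have dc (s : R) : is_derive s 1 (fun s : R => cos (ga * s)) (- (ga * sin (ga * s))).
  have := @is_derive1_comp _ cos (fun s : R => ga * s) s _ _ (is_derive_cos _) (dl s).
  by move=> /is_derive_eq; apply; ring.
have ds (s : R) : is_derive s 1 (fun s : R => sin (ga * s)) (ga * cos (ga * s)).
  have := @is_derive1_comp _ sin (fun s : R => ga * s) s _ _ (is_derive_sin _) (dl s).
  by move=> /is_derive_eq; apply; ring.
have dw (s : R) : is_derive s 1 w (w' s).
  have := is_deriveM (dE s) (is_deriveB (dc s) (is_deriveZ ka (ds s))).
  move=> /is_derive_eq; apply.
  by rewrite /w' /ka' /ka !fctE /= /GRing.scale/=; field.
have dw' (s : R) : is_derive s 1 w' (w'' s).
  have := is_deriveM (dE s)
    (is_deriveZ (- (1 / 2)) (is_deriveD (dc s) (is_deriveZ ka' (ds s)))).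
  move=> /is_derive_eq; apply.
  by rewrite /w'' /ka' !fctE /= /GRing.scale/=; field.
have ode s : w'' s + 2 * al * w' s + (al ^+ 2 + ga ^+ 2) * w s = 0.
  by rewrite /w /w' /w'' /ka /ka'; field.
have E_gt0 s : 0 < E s by exact: expR_gt0.
have kk : 0 < ka + ka'.
  have -> : ka + ka' = (2 * ga ^+ 2 + 2 * (al - 1 / 2) ^+ 2) / ga.
    by rewrite /ka /ka'; field.
  rewrite divr_gt0// ltr_pwDl ?mulr_gt0 ?exprn_gt0//.
  by rewrite mulr_ge0 ?sqr_ge0.
(* In terms of the cotangent of ga s, which decreases on ]0, pi[, w vanishes at ka
   and w' at - ka' < ka.  The time s1 is the one where it equals the midpoint
   mu. *)
pose mu : R := (ka - ka') / 2.
pose psi : R := pi / 2 - atan mu.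
have at1 := atan_gtNpi2 mu; have at2 := atan_ltpi2 mu.
have psi_gt0 : 0 < psi by rewrite subr_gt0.
have psi_ltpi : psi < pi by rewrite /psi; lra.
have ca_gt0 : 0 < cos (atan mu) by apply: cos_gt0_pihalf; rewrite at1 at2.
have sinpsi : sin psi = cos (atan mu) by rewrite /psi sinB sin_pihalf cos_pihalf; ring.
have cospsi : cos psi = mu * cos (atan mu).
  rewrite /psi cosB cos_pihalf sin_pihalf mul0r add0r mul1r.
  by rewrite -{2}(atanK mu) /tan divfK ?gt_eqF.
pose s1 : R := psi / ga.
have s1_gt0 : 0 < s1 by rewrite divr_gt0.
have gas1 : ga * s1 = psi by rewrite /s1; field.
have w'_lt0 s : 0 <= s <= s1 -> w' s < 0.
  move=> /andP[s_ge0 ss1].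
  have gs_le : ga * s <= psi by rewrite -gas1 ler_pM2l.
  have gs_ge0 : 0 <= ga * s by rewrite mulr_ge0// ltW.
  rewrite /w' pmulr_rlt0// mulNr oppr_lt0 pmulr_rgt0//.
  move: s_ge0; rewrite le_eqVlt => /predU1P[<-|s_gt0].
    by rewrite mulr0 cos0 sin0 mulr0 addr0.
  have gs_gt0 : 0 < ga * s by rewrite mulr_gt0.
  have sin_gt0 : 0 < sin (ga * s).
    by apply: sin_gt0_pi; rewrite gs_gt0 (le_lt_trans gs_le).
  have : 0 <= sin (psi - ga * s).
    by apply: sin_ge0_pi; rewrite subr_ge0 gs_le/=; lra.
  have -> : sin (psi - ga * s) =
    cos (atan mu) * (cos (ga * s) - mu * sin (ga * s)).
    by rewrite sinB sinpsi cospsi; ring.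
  rewrite pmulr_rge0// subr_ge0 => mus.
  have : 0 < (mu + ka') * sin (ga * s).
    by rewrite mulr_gt0// /mu; lra.
  by rewrite mulrDl => /lt_le_trans; apply; rewrite lerD2r.
have cw' : {within `[0, s1], continuous w'}.
  by apply: derivable_within_continuous => s _; exact: ex_derive.
have cw : {within `[0, s1], continuous (fun s => `|w s|)}.
  apply: continuous_subspaceT => s; apply: cvg_norm.
  by apply/differentiable_continuous/derivable1_diffP; exact: ex_derive.
have [a a_in w'max] := EVT_max (ltW s1_gt0) cw'.
have [b b_in wmax] := EVT_max (ltW s1_gt0) cw.
have w0 : w 0 = 1 by rewrite /w /E !mulr0 expR0 cos0 sin0; ring.
exists w, w', w'', s1, `|w b|, (- w' a); split => //.
- split => //; rewrite /w' /E !mulr0 expR0 cos0 sin0; ring.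
- rewrite /w pmulr_rlt0// gas1 cospsi sinpsi -mulrBl pmulr_llt0//.
  by rewrite /mu; lra.
- by rewrite oppr_gt0 w'_lt0// -in_itv.
split.
  apply: lt_le_trans (wmax 0 _); first by rewrite w0 normr1.
  by rewrite in_itv/= lexx ltW.
move=> s s_in; rewrite opprK; split; [exact: w'max|exact: wmax].
Qed.

(** The damping of the linearization at phi_infty is N - 2 - 4 c and its
    equation oscillates iff the square of that number is below 8 k; for a
    nonnegative damping this is the condition p < p_JL, and there is room for
    a slightly larger damping a.  A negative damping can be replaced by 0. *)
Lemma subcritical_damping (R : realType) (N : nat) (p : R) : (3 <= N)%N ->
  serrin_exponent R N < p -> (p%:E < joseph_lundgren_exponent R N)%E ->
  let c := (p - 1)^-1 in let k := N%:R - 2 - 2 * c in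
  [/\ 1 < p, 0 < k &
    exists2 a : R, N%:R - 2 - 4 * c < a & a ^+ 2 < 8 * k].
Proof.
move=> N_ge3 p_gt p_lt c k.
have n_ge3 : 3 <= N%:R :> R by rewrite (ler_nat R 3 N).
move: p_gt p_lt; rewrite /serrin_exponent /joseph_lundgren_exponent.
set n : R := N%:R in n_ge3 k *.
rewrite ltr_pdivrMr; last lra.
move=> p_gt p_lt.
have p_gt1 : 1 < p by nra.
have p1_gt0 : 0 < p - 1 by lra.
have c_gt0 : 0 < c by rewrite invr_gt0.
have pc : (p - 1) * c = 1 by rewrite divff ?gt_eqF.
have k_gt0 : 0 < k by rewrite /k; nra.
split => //.
have [a_lt0|a_ge0] := ltrP (n - 2 - 4 * c) 0.
  by exists 0 => //; rewrite expr0n/= mulr_gt0.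
(* Here |4 c - (N - 4)| < 2 sqrt (N - 1) is to be proved in squared form. *)
have JL : (n - 2 - 4 * c) ^+ 2 < 8 * k.
  rewrite /k; case: ltnP p_lt => [N_gt10|N_le10] p_lt.
    have n_gt10 : 10 < n by rewrite (ltr_nat R 10 N).
    move: p_lt; rewrite lte_fin.
    have s_ge0 := sqrtr_ge0 (n - 1).
    have s2 : Num.sqrt (n - 1) ^+ 2 = n - 1 by rewrite sqr_sqrtr; lra.
    set s := Num.sqrt (n - 1) in s_ge0 s2 *.
    have s_gt2 : 2 < s by nra.
    rewrite ltr_pdivlMr; last by rewrite mulr_gt0//; lra.
    have -> : (n - 2) * (n - 10) = (n - 4 - 2 * s) * (n - 4 + 2 * s).
      have -> : (n - 4 - 2 * s) * (n - 4 + 2 * s) =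
        (n - 4) ^+ 2 - 4 * s ^+ 2 by ring.
      by rewrite s2; ring.
    have -> : (n - 2) ^+ 2 - 4 * n + 8 * s =
        (n - 4 - 2 * s) * (n - 4 + 2 * s) + 4 * (n - 4 + 2 * s).
      have -> : (n - 4 - 2 * s) * (n - 4 + 2 * s) =
        (n - 4) ^+ 2 - 4 * s ^+ 2 by ring.
      by rewrite s2; ring.
    move=> plt.
    have t_gt0 : 0 < n - 4 + 2 * s by lra.
    have {plt} : (p - 1) * (n - 4 - 2 * s) < 4.
      rewrite -(ltr_pM2r t_gt0); move: plt; lra.
    move=> plt.
    have lo : n - 4 - 2 * s < 4 * c.
      have : c * ((p - 1) * (n - 4 - 2 * s)) < c * 4 by rewrite ltr_pM2l.
      rewrite mulrA [c * (p - 1)]mulrC pc; lra.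
    have : (4 * c - (n - 4)) ^+ 2 < 4 * s ^+ 2 by nra.
    rewrite s2; nra.
  have n_le10 : n <= 10 by rewrite (ler_nat R N 10).
  have -> : (n - 2 - 4 * c) ^+ 2 = 8 * (n - 2 - 2 * c) -
    ((10 - n) * (n - 2 - 4 * c) + 16 * c + 4 * c * (n - 2 - 4 * c)) by ring.
  rewrite ltrBlDr ltrDl; nra.
have s_ge0 := sqrtr_ge0 (8 * k).
have s2 : Num.sqrt (8 * k) ^+ 2 = 8 * k by rewrite sqr_sqrtr//; lra.
exists ((n - 2 - 4 * c + Num.sqrt (8 * k)) / 2); nra.
Qed.

(** * The two pieces of the profile *)

(** The exponent - c makes x^(-c) scale like the equation: c p = c + 1. *)
Lemma powR_steady_exponent (R : realType) (p x : R) : 1 < p -> 0 < x ->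
  (x `^ (- (p - 1)^-1)) `^ p = x `^ (- (p - 1)^-1) / x.
Proof.
move=> p_gt1 x_gt0; rewrite -powRrM -powR_subr1//; congr (_ `^ _).
by field; rewrite subr_eq0 gt_eqF.
Qed.

Lemma is_derive_powRN (R : realType) (c x : R) : 0 < x ->
  is_derive (x : R) 1 (fun y => y `^ (- c)) (- c * (x `^ (- c) / x)).
Proof.
move=> x_gt0; apply: is_derive_eq (is_derive1_powR (- c) x_gt0) _.
by rewrite powR_subr1.
Qed.

(** With L the coefficient of phi_infty and e = 0, the left-hand side of the
    supersolution inequality for this profile is
    - 4 c (c + 1) L (1 + q)^(-c-2), whatever the value of p. *)
Definition inner_profile (R : realType) (p L q : R) : R :=
  L * (1 + q) `^ (- (p - 1)^-1).

Lemma is_derive_inner_profile (R : realType) (p L q : R) : 0 < 1 + q ->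
  is_derive (q : R) 1 (inner_profile p L)
    (- (p - 1)^-1 * (inner_profile p L q / (1 + q))).
Proof.
move=> q_gt; have dl : is_derive (q : R) 1 (fun r : R => 1 + r) 1.
  by apply: is_derive_eq; ring.
have := @is_derive1_comp _ (fun y => y `^ (- (p - 1)^-1)) (fun r : R => 1 + r)
  q _ _ (is_derive_powRN (p - 1)^-1 q_gt) dl.
move=> /(is_deriveZ L)/is_derive_eq; apply.
by rewrite /inner_profile /GRing.scale/=; ring.
Qed.

Lemma inner_profile_supersolution (R : realType) (N : nat) (p e L q : R) :
  let c := (p - 1)^-1 in
  1 < p -> 0 < L -> L `^ (p - 1) = 2 * c * (N%:R - 2 - 2 * c) ->
  0 <= q -> e * (1 + q) < 4 * (c + 1) ->
  strict_supersolution_at N p e (inner_profile p L) q.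
Proof.
move=> c p_gt1 L_gt0 Lp q_ge0 e_small.
have c_gt0 : 0 < c by rewrite invr_gt0 subr_gt0.
have q1_gt0 : 0 < 1 + q by lra.
set g := inner_profile p L.
exists (fun r => - c * (g r / (1 + r))).
exists (c * (c + 1) * (g q / (1 + q) / (1 + q))); split.
- have : \forall r \near q, -1 < r by apply: lt_nbhsr; lra.
  by apply: filterS => r r_gt; apply: is_derive_inner_profile; lra.
- have dl : is_derive (q : R) 1 (fun r : R => 1 + r) 1.
    by apply: is_derive_eq; ring.
  have := is_deriveZ (- c) (is_deriveM (is_derive_inner_profile p L q1_gt0)
    (is_deriveV (lt0r_neq0 q1_gt0) dl)).
  move=> /is_derive_eq; apply; rewrite -/g -/c /GRing.scale/=.
  by field; rewrite gt_eqF.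
have gp : g q `^ p = 2 * c * (N%:R - 2 - 2 * c) * (g q / (1 + q)).
  rewrite /g /inner_profile powRM ?powR_ge0 ?(ltW L_gt0)//.
  rewrite powR_steady_exponent// -Lp powR_subr1//.
  by field; rewrite !gt_eqF.
have gq_gt0 : 0 < g q by rewrite mulr_gt0// powR_gt0.
rewrite gp.
have -> : 4 * q * (c * (c + 1) * (g q / (1 + q) / (1 + q))) +
    2 * N%:R * (- c * (g q / (1 + q))) +
    2 * c * (N%:R - 2 - 2 * c) * (g q / (1 + q)) +
    e * (g q / (p - 1) + q * (- c * (g q / (1 + q)))) =
  c * (g q / (1 + q) / (1 + q)) * (e * (1 + q) - 4 * (c + 1)).
  by rewrite -/c; set G := g q; field; rewrite gt_eqF.
by rewrite pmulr_rlt0 ?subr_lt0// mulr_gt0// !divr_gt0.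
Qed.

Lemma is_derive_powR_ln (R : realType) (c q d : R) (h : R -> R) : 0 < q ->
  is_derive (ln q : R) 1 h d ->
  is_derive (q : R) 1 (fun r => r `^ (- c) * h (ln r))
    (q `^ (- (c + 1)) * (d - c * h (ln q))).
Proof.
move=> q_gt0 dh.
have dhl := @is_derive1_comp _ h (@ln R) q _ _ dh (is_derive1_ln q_gt0).
have := is_deriveM (is_derive_powRN c q_gt0) dhl.
move=> /is_derive_eq; apply; rewrite opprD powR_subr1// /GRing.scale/=.
by field; rewrite gt_eqF.
Qed.

(** The Emden variable: a perturbation w relative to phi_infty, as a function of
    ln q, satisfies an autonomous equation. *)
Definition outer_profile (R : realType) (p L : R) (w : R -> R) (q : R) : R :=
  L * (q `^ (- (p - 1)^-1) * (1 - w (ln q))).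

Lemma is_derive_outer_profile (R : realType) (p L q d : R) (w : R -> R) :
  let c := (p - 1)^-1 in
  0 < q -> is_derive (ln q : R) 1 w d ->
  is_derive (q : R) 1 (outer_profile p L w)
    (L * (q `^ (- (c + 1)) * (- d - c * (1 - w (ln q))))).
Proof.
move=> c q_gt0 dw.
have dh : is_derive (ln q : R) 1 (fun l => 1 - w l) (- d).
  by apply: is_derive_eq; ring.
exact: (is_deriveZ L (is_derive_powR_ln c q_gt0 dh)).
Qed.

(** In the variable ln q, the linear part of the inequality is
    4 w'' + 2 (N - 2 - 4 c) w' + 2 k w.  The equation assumed of w has damping a
    instead, which leaves a surplus proportional to - w'; the hypothesis gap says
    that it dominates the nonlinear remainder and the term with e. *)
Lemma outer_profile_supersolution (R : realType) (N : nat) (p e L q a : R)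
    (w w' w'' : R -> R) :
  let c := (p - 1)^-1 in let k := N%:R - 2 - 2 * c in
  1 < p -> 0 < L -> L `^ (p - 1) = 2 * c * k -> 0 < q ->
  (forall l : R, is_derive l 1 w (w' l)) ->
  (forall l : R, is_derive l 1 w' (w'' l)) ->
  (forall l, 4 * w'' l + 2 * a * w' l + 2 * k * w l = 0) ->
  w (ln q) < 1 ->
  2 * c * k * ((1 - w (ln q)) `^ p - 1 + p * w (ln q)) + e * q * (- w' (ln q))
    < 2 * (a - (N%:R - 2 - 4 * c)) * (- w' (ln q)) ->
  strict_supersolution_at N p e (outer_profile p L w) q.
Proof.
move=> c k p_gt1 L_gt0 Lp q_gt0 dw dw' ode w_lt1 gap.
have pc : (p - 1) * c = 1 by rewrite divff// subr_eq0 gt_eqF.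
set l := ln q in w_lt1 gap *.
exists (fun r => L * (r `^ (- (c + 1)) * (- w' (ln r) - c * (1 - w (ln r))))).
exists (L * (q `^ (- (c + 1 + 1)) * ((- w'' l + c * w' l) -
  (c + 1) * (- w' l - c * (1 - w l))))); split.
- have := lt_nbhsr q_gt0; apply: filterS => r r_gt0.
  exact: is_derive_outer_profile.
- have dh : is_derive (l : R) 1 (fun l => - w' l - c * (1 - w l))
      (- w'' l + c * w' l).
    have dw1 : is_derive (l : R) 1 (fun l => 1 - w l) (- w' l).
      by apply: is_derive_eq; ring.
    have := is_deriveB (is_deriveN (dw' l)) (is_deriveZ c dw1).
    by move=> /is_derive_eq; apply; rewrite /GRing.scale/=; ring.
  exact: (is_deriveZ L (is_derive_powR_ln (c + 1) q_gt0 dh)).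
set X := q `^ (- c).
have X_gt0 : 0 < X by exact: powR_gt0.
have X1 : q `^ (- (c + 1)) = X / q by rewrite opprD powR_subr1.
have X2 : q `^ (- (c + 1 + 1)) = X / q / q by rewrite opprD powR_subr1// X1.
have gE : outer_profile p L w q = L * (X * (1 - w l)) by [].
set v := 1 - w l in gap gE *.
have v_gt0 : 0 < v by rewrite subr_gt0.
have gp : outer_profile p L w q `^ p = L * (X / q) * (2 * c * k * v `^ p).
  rewrite gE powRM ?mulr_ge0 ?(ltW L_gt0) ?(ltW X_gt0) ?(ltW v_gt0)//.
  rewrite powRM ?(ltW X_gt0) ?(ltW v_gt0)// /X powR_steady_exponent// -/c.
  rewrite -Lp powR_subr1//.
  by set vp := v `^ p; set Xc := q `^ _; field; rewrite !gt_eqF.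
rewrite gp gE X1 X2 -/l -/v -/c.
set vp := v `^ p in gap *.
have -> : 4 * q * (L * (X / q / q * (- w'' l + c * w' l - (c + 1) * (- w' l - c * v)))) +
    2 * N%:R * (L * (X / q * (- w' l - c * v))) + L * (X / q) * (2 * c * k * vp) +
    e * (L * (X * v) / (p - 1) + q * (L * (X / q * (- w' l - c * v)))) =
  L * (X / q) * (- (4 * w'' l + 2 * a * w' l + 2 * k * w l) +
    (2 * c * k * (vp - 1 + p * w l) + e * q * (- w' l)) -
    2 * (a - (N%:R - 2 - 4 * c)) * (- w' l) +
    2 * k * (1 - (p - 1) * c) * w l).
  rewrite -/c /v /k; set Nr := N%:R.
  by field; rewrite gt_eqF.
rewrite ode pc subrr mulr0 mul0r addr0 oppr0 add0r.
by rewrite pmulr_rlt0 ?subr_lt0// mulr_gt0// divr_gt0.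
Qed.

(** * The glued profile *)

(** The order of the choices matters.  The oscillation (hence s1, M and m) depends
    only on the damping; then the corner q0 is taken so far out that
    the amplitude C of w is as small as Taylor's formula requires; then e is
    taken small in terms of Q = q0 exp s1. *)
Lemma exists_profile (R : realType) (N : nat) (p L a : R) :
  let c := (p - 1)^-1 in let k := N%:R - 2 - 2 * c in
  1 < p -> 0 < k -> 0 < L -> L `^ (p - 1) = 2 * c * k ->
  N%:R - 2 - 4 * c < a -> a ^+ 2 < 8 * k ->
  exists (G : R -> R) (e Q mu Ga : R), [/\
    [/\ 0 < e, 0 < Q & 0 < mu],
    forall q : R, 0 <= q -> {for q, continuous G},
    forall q : R, 0 <= q <= Q -> mu <= G q <= Ga,
    forall q : R, 0 <= q < Q -> strict_profile_at N p e G q &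
    L * Q `^ (- c) < G Q].
Proof.
move=> c k p_gt1 k_gt0 L_gt0 Lp a_gt a2_lt.
have c_gt0 : 0 < c by rewrite invr_gt0 subr_gt0.
pose D : R := a - (N%:R - 2 - 4 * c).
have D_gt0 : 0 < D by rewrite subr_gt0.
pose ga : R := Num.sqrt (k / 2 - (a / 4) ^+ 2).
have ga2 : ga ^+ 2 = k / 2 - (a / 4) ^+ 2 by rewrite sqr_sqrtr//; nra.
have ga_gt0 : 0 < ga by rewrite sqrtr_gt0; nra.
have [W [W' [W'' [s1 [M [m []]]]]]] := damped_oscillation (a / 4) ga_gt0.
move=> [dW dW' odeW W0 W'0] s1_gt0 Ws1 m_gt0 [M_gt0 Wbound].
have [d d_gt0 taylor] := powR_expansion p
  (divr_gt0 (mulr_gt0 D_gt0 m_gt0) (mulr_gt0 (mulr_gt0 (mulr_gt0 (ltr0Sn R 1)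
    c_gt0) k_gt0) M_gt0)).
have dM_gt0 : 0 < Num.min d (1 / 2) / M by rewrite divr_gt0// lt_min d_gt0/=.
have [x x_gt0 /=] := corner_inequality c_gt0 dM_gt0.
set y := (1 + x) `^ (- c).
move=> [y_gt0 C_gt0 C_le kink].
pose C : R := 1 - y.
pose q0 : R := x^-1.
have q0_gt0 : 0 < q0 by rewrite invr_gt0.
pose w (l : R) := C * W (l - ln q0).
pose w' (l : R) := C * W' (l - ln q0).
pose w'' (l : R) := C * W'' (l - ln q0).
have dshift (l : R) : is_derive l 1 (fun l : R => l - ln q0) 1.
  by apply: is_derive_eq; ring.
have dw (l : R) : is_derive l 1 w (w' l).
  have := @is_derive1_comp _ W (fun l => l - ln q0) l _ _ (dW _) (dshift l).
  by move=> /(is_deriveZ C)/is_derive_eq; apply; rewrite mulr1.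
have dw' (l : R) : is_derive l 1 w' (w'' l).
  have := @is_derive1_comp _ W' (fun l => l - ln q0) l _ _ (dW' _) (dshift l).
  by move=> /(is_deriveZ C)/is_derive_eq; apply; rewrite mulr1.
have ode l : 4 * w'' l + 2 * a * w' l + 2 * k * w l = 0.
  have := odeW (l - ln q0); rewrite ga2 => ode0.
  rewrite /w /w' /w''.
  transitivity (4 * C * (W'' (l - ln q0) + 2 * (a / 4) * W' (l - ln q0) +
    ((a / 4) ^+ 2 + (k / 2 - (a / 4) ^+ 2)) * W (l - ln q0))); first by field.
  by rewrite ode0 mulr0.
pose Q : R := q0 * expR s1.
have q0Q : q0 < Q by rewrite ltr_pMr// expR_gt1.
have Q_gt0 : 0 < Q by exact: lt_trans q0Q.
have lnQ : ln Q - ln q0 = s1.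
  by rewrite lnM ?posrE ?expR_gt0// expRK addrAC subrr add0r.
have range q : q0 <= q <= Q -> 0 <= ln q - ln q0 <= s1.
  move=> /andP[q0q qQ]; have q_gt0 : 0 < q by exact: lt_le_trans q0q.
  by rewrite subr_ge0 -lnQ lerD2r !ler_ln ?posrE// q0q qQ.
have w_small q : q0 <= q <= Q -> `|w (ln q)| <= Num.min d (1 / 2).
  move=> /range/Wbound[_ WM]; rewrite /w normrM gtr0_norm//.
  apply: (@le_trans _ _ (C * M)); first by rewrite ler_pM2l.
  by rewrite -ler_pdivlMr.
have w_lt1 q : q0 <= q <= Q -> w (ln q) < 1.
  move=> /w_small; rewrite le_min => /andP[_ w2].
  by apply: le_lt_trans (le_trans (ler_norm _) w2) _; rewrite mul1r invf_lt1 ?ltr1n.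
pose e : R := Num.min (D / (2 * Q)) (2 * (c + 1) / (1 + q0)).
have e_gt0 : 0 < e.
  rewrite lt_min; apply/andP; split; apply: divr_gt0.
  - exact: D_gt0.
  - exact: mulr_gt0.
  - by apply: mulr_gt0 => //; exact: addr_gt0.
  - exact: addr_gt0.
have eQ : e * Q < D.
  have : e <= D / (2 * Q) by rewrite ge_min lexx.
  rewrite -(ler_pM2r Q_gt0) => /le_lt_trans; apply.
  have -> : D / (2 * Q) * Q = D / 2 by field; rewrite gt_eqF.
  lra.
have eq0 : e * (1 + q0) < 4 * (c + 1).
  have q01 : 0 < 1 + q0 by exact: addr_gt0.
  have : e <= 2 * (c + 1) / (1 + q0) by rewrite ge_min lexx orbT.
  rewrite ler_pdivlMr//; lra.
set g1 := inner_profile p L; set g2 := outer_profile p L w.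
have super1 q : 0 <= q <= q0 -> strict_supersolution_at N p e g1 q.
  move=> /andP[q_ge0 qq0]; apply: inner_profile_supersolution => //.
  by apply: le_lt_trans eq0; rewrite ler_pM2l// lerD2l.
have super2 q : q0 <= q <= Q -> strict_supersolution_at N p e g2 q.
  move=> qr; have q_gt0 : 0 < q by case/andP: qr => /(lt_le_trans q0_gt0).
  apply: (outer_profile_supersolution (w' := w') (w'' := w'') (a := a)) => //.
    exact: w_lt1.
  rewrite -/c -/k -/D.
  have [W'm WM] := Wbound _ (range q qr).
  have w'_le : C * m <= - w' (ln q) by rewrite /w' -mulrN ler_pM2l// lerNr.
  have w'_gt0 : 0 < - w' (ln q) by apply: lt_le_trans w'_le; rewrite mulr_gt0.
  have wM : `|w (ln q)| <= C * M by rewrite /w normrM gtr0_norm// ler_pM2l.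
  have := taylor (- w (ln q)); rewrite normrN => /(_ _)/wrap[].
    by apply: le_trans (w_small q qr) _; rewrite ge_min lexx.
  rewrite mulrN opprK => /(le_trans (ler_norm _)) nonlin.
  have ck_gt0 : 0 < 2 * c * k by rewrite !mulr_gt0.
  have part1 : 2 * c * k * ((1 - w (ln q)) `^ p - 1 + p * w (ln q)) <=
      D * (- w' (ln q)).
    apply: (@le_trans _ _ (2 * c * k * (D * m / (2 * c * k * M) * (C * M)))).
      rewrite ler_pM2l//; apply: le_trans nonlin _.
      by rewrite ler_pM2l// divr_gt0 ?mulr_gt0.
    have -> : 2 * c * k * (D * m / (2 * c * k * M) * (C * M)) = D * (C * m).
      by field; rewrite !gt_eqF.
    by rewrite ler_pM2l.
  have part2 : e * q * (- w' (ln q)) < D * (- w' (ln q)).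
    rewrite ltr_pM2r//; apply: le_lt_trans eQ; rewrite ler_pM2l//.
    by case/andP: qr.
  have -> : 2 * D * - w' (ln q) = D * - w' (ln q) + D * - w' (ln q) by ring.
  exact: ler_ltD.
have glue : g1 q0 = g2 q0.
  rewrite /g1 /g2 /inner_profile /outer_profile /w subrr W0 mulr1 /C subKr.
  congr (_ * _); rewrite /y -powRM ?(ltW q0_gt0) ?addr_ge0 ?(ltW x_gt0)//.
  by congr (_ `^ _); rewrite /q0; field; rewrite gt_eqF.
(* The concave corner: g2 has the smaller derivative at q0. *)
have near_g2_le : \forall q \near q0, q0 < q -> g2 q <= g1 q.
  have d1 := is_derive_inner_profile p L (addr_gt0 ltr01 q0_gt0).
  have d2 := is_derive_outer_profile p L q0_gt0 (dw (ln q0)).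
  have dd := is_derive_cvg_quotient (is_deriveB d1 d2).
  have : \forall h \near 0^', 0 < h^-1 *: ((g1 - g2) (h *: (1 : R) + q0) - (g1 - g2) q0).
    apply: (cvgr_gt _ dd); rewrite -/g1 -/c subr_gt0.
    rewrite glue /g2 /outer_profile -/c /w' /w subrr W0 W'0 mulr1 /C subKr.
    rewrite opprD powR_subr1//.
    have q01_neq0 : 1 + q0 != 0 by rewrite gt_eqF// addr_gt0.
    have -> : - c * (L * (q0 `^ (- c) * y) / (1 + q0)) =
      L * (q0 `^ (- c) / q0 * (- c * y * (q0 / (1 + q0)))).
      set X := q0 `^ _; set qq := q0 in q0_gt0 q01_neq0 *.
      by field; rewrite q01_neq0 gt_eqF.
    rewrite ltr_pM2l// ltr_pM2l ?divr_gt0 ?powR_gt0//.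
    have -> : q0 / (1 + q0) = 1 - x / (1 + x).
      by rewrite /q0; field; rewrite !gt_eqF// addr_gt0.
    move: kink; lra.
  move=> [r /= r_gt0 Hr]; exists r => //= q qr q0q.
  have := Hr (q - q0); rewrite /ball_/= sub0r normrN distrC.
  move=> /(_ qr); rewrite subr_eq0 gt_eqF// => /(_ isT).
  have -> : (q - q0) *: (1 : R) + q0 = q by rewrite /GRing.scale/= mulr1 subrK.
  rewrite !fctE glue subrr subr0 /GRing.scale/= pmulr_rgt0 ?invr_gt0 ?subr_gt0//.
  exact: ltW.
(* Equal to g1 up to q0 and to g2 from there on, and manifestly continuous. *)
pose G (q : R) := g1 (Num.min q q0) + g2 (Num.max q q0) - g1 q0.
have G1 q : q <= q0 -> G q = g1 q.
  by move=> qq0; rewrite /G min_l// max_r// -glue addrK.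
have G2 q : q0 <= q -> G q = g2 q.
  by move=> qq0; rewrite /G min_r// max_l// addrAC subrr add0r.
have cG q : 0 <= q -> {for q, continuous G}.
  move=> q_ge0.
  have cmin : {for q, continuous (fun r : R => Num.min r q0)}.
    by apply: continuous_min; [exact: cvg_id|exact: cvg_cst].
  have cmax : {for q, continuous (fun r : R => Num.max r q0)}.
    by apply: continuous_max; [exact: cvg_id|exact: cvg_cst].
  have c1 : {for Num.min q q0, continuous g1}.
    apply/differentiable_continuous/derivable1_diffP.
    have min_gt : 0 < 1 + Num.min q q0.
      by rewrite ltr_pwDl// le_min q_ge0 ltW.
    by have := is_derive_inner_profile p L min_gt => ?; exact: ex_derive.
  have c2 : {for Num.max q q0, continuous g2}.
    apply/differentiable_continuous/derivable1_diffP.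
    have max_gt : 0 < Num.max q q0 by rewrite lt_max q0_gt0 orbT.
    have := is_derive_outer_profile p L max_gt (dw (ln (Num.max q q0))).
    by move=> ?; exact: ex_derive.
  exact: (cvgB (cvgD (continuous_comp cmin c1) (continuous_comp cmax c2))
    (cvg_cst (g1 q0))).
have G_gt0 q : 0 <= q <= Q -> 0 < G q.
  move=> /andP[q_ge0 qQ]; have [qq0|q0q] := leP q q0.
    by rewrite G1// mulr_gt0// powR_gt0// ltr_wpDr.
  have q_gt0 : 0 < q by exact: lt_trans q0q.
  rewrite G2 ?(ltW q0q)// /g2 /outer_profile !mulr_gt0 ?powR_gt0//.
  by rewrite subr_gt0 w_lt1// (ltW q0q).
have cGQ : {within `[0, Q], continuous G}.
  apply: continuous_in_subspaceT => q.
  by rewrite inE/= in_itv/= => /andP[q_ge0 _]; exact: cG.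
have [qm qm_in Gmin] := EVT_min (ltW Q_gt0) cGQ.
have [qM qM_in Gmax] := EVT_max (ltW Q_gt0) cGQ.
exists G, e, Q, (G qm), (G qM); split => //.
- by split => //; rewrite G_gt0// -in_itv.
- by move=> q q_in; rewrite Gmin ?Gmax// in_itv.
- move=> q /andP[q_ge0 qQ]; have [qq0|q0q] := leP q q0.
    exists g1; split; first by rewrite G1.
      move: qq0; rewrite le_eqVlt => /predU1P[->|qq0].
        apply: filterS near_g2_le => r r_near _.
        have [rq0|q0r] := leP r q0; first by rewrite G1.
        by rewrite G2 ?(ltW q0r)// r_near.
      have : \forall r \near q, r < q0 by exact: lt_nbhsl.
      apply: filterS => r r_lt _.
      by rewrite G1// ltW.
    by apply: super1; rewrite q_ge0.
  exists g2; split; first by rewrite G2// ltW.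
    have := lt_nbhsr q0q; apply: filterS => r r_gt _.
    by rewrite G2// ltW.
  by apply: super2; rewrite !ltW.
- rewrite G2 ?(ltW q0Q)// ltr_pM2l// -/c ltr_pMr ?powR_gt0//.
  by rewrite ltrDl oppr_gt0 /w lnQ pmulr_rlt0.
Qed.

(** * Classical solutions *)

Lemma classical_ancient_solution (R : realType) (N : nat) (p : R)
    (u : 'rV[R]_N -> R -> R) : classical_solution p u ->
  ancient_solution p u (dt u) (fun i => dx i u) (fun i => dx i (dx i u)).
Proof.
move=> [[cu dtu _ dxu _ dxxu _] eqn]; split => //.
- move=> z.
  pose f (z : 'rV[R]_N * R) := u z.1 z.2.
  pose clamp (z : 'rV[R]_N * R) := (z.1, Num.min z.2 0).
  have cclamp : {for z, continuous clamp}.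
    have c1 : {for z, continuous (@fst 'rV[R]_N R)} by exact: cvg_fst.
    have c2 : {for z, continuous (@snd 'rV[R]_N R)} by exact: cvg_snd.
    have c0 : {for z, continuous (cst 0 : 'rV[R]_N * R -> R)} by exact: cvg_cst.
    exact: (cvg_pair c1 (continuous_min c2 c0)).
  have clamp_in y : (clamp y).2 <= 0 by rewrite /= ge_min lexx orbT.
  have fz := (subspace_continuousP _ f).1 cu (clamp z) (clamp_in z).
  move=> P /fz fP.
  have {}fP : \forall y \near clamp z, y.2 <= 0 -> P (f y) by exact: fP.
  have : \forall y \near z, (clamp y).2 <= 0 -> P (f (clamp y)).
    by have := cclamp _ fP.
  by apply: filterS => y; exact.
- by move=> i x t t_le0; exact/derivableP/dxu.
- by move=> i x t t_le0; exact/derivableP/dxxu.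
Qed.

Lemma ancient_solutionN (R : realType) (N : nat) (p : R)
    (u ut : 'rV[R]_N -> R -> R) (ux uxx : 'I_N -> 'rV[R]_N -> R -> R) :
  ancient_solution p u ut ux uxx ->
  ancient_solution p (fun x t => - u x t) (fun x t => - ut x t)
    (fun i x t => - ux i x t) (fun i x t => - uxx i x t).
Proof.
move=> us; split.
- by move=> z; apply: cvgN; exact: (anc_continuous us z).
- move=> x t t_le0.
  under eq_cvg => h do rewrite -opprD mulrN.
  exact: (cvgN (anc_dt us x t t_le0)).
- by move=> i x t t_le0; have := anc_dx us i x t t_le0 => ?; exact: is_deriveN.
- by move=> i x t t_le0; have := anc_dxx us i x t t_le0 => ?; exact: is_deriveN.
- move=> x t t_le0.
  by rewrite (anc_eq us x t t_le0) opprD sumrN normrN mulrN.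
Qed.

Lemma phi_inftyE (R : realType) (N : nat) (p : R) (x : 'rV[R]_N) :
  phi_infty p x = sing_coef N p * sqnorm x `^ (- (p - 1)^-1).
Proof.
rewrite /phi_infty /enorm -/(sqnorm x) -powR12_sqrt ?sqnorm_ge0// -powRrM.
by congr (_ * _ `^ _); rewrite mulrN mulrA mulVf// mul1r.
Qed.

Unset Implicit Arguments.
Set Strict Implicit.

Theorem theorem1 (R : realType) (N : nat) (p : R) (u : 'rV[R]_N -> R -> R)
    (N_ge3 : (3 <= N)%N)
    (p_gt_sg : serrin_exponent R N < p)
    (p_lt_JL : (p%:E < joseph_lundgren_exponent R N)%E)
    (u_sol : classical_solution p u)
    (u_bound : forall (x : 'rV[R]_N) (t : R),
       x != 0 -> t <= 0 -> `|u x t| <= phi_infty p x) :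
  forall (x : 'rV[R]_N) (t : R), t <= 0 -> u x t = 0.
Proof.
have [p_gt1 k_gt0 [a a_gt a2_lt]] := subcritical_damping N_ge3 p_gt_sg p_lt_JL.
have p1_gt0 : 0 < p - 1 by rewrite subr_gt0.
have base_gt0 : 0 < 2 / (p - 1) * (N%:R - 2 - 2 / (p - 1)).
  by rewrite mulr_gt0// divr_gt0.
have L_gt0 : 0 < sing_coef N p by exact: powR_gt0.
have Lp : sing_coef N p `^ (p - 1) =
    2 * (p - 1)^-1 * (N%:R - 2 - 2 * (p - 1)^-1).
  by rewrite /sing_coef -powRrM mul1r mulVf ?gt_eqF// powRr1// ltW.
have [G [e [Q [mu [Ga [[e_gt0 Q_gt0 mu_gt0] cG muG superG GQ]]]]]] :=
  exists_profile p_gt1 k_gt0 L_gt0 Lp a_gt a2_lt.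
have us := classical_ancient_solution u_sol.
move=> x t t_le0; apply/eqP; rewrite eq_le; apply/andP; split.
- apply: (nonpos_of_profile us p_gt1 e_gt0 Q_gt0 mu_gt0 cG muG superG GQ) => //.
  move=> y s y_neq0 s_le0; rewrite -phi_inftyE.
  exact: le_trans (ler_norm _) (u_bound y s y_neq0 s_le0).
- rewrite -oppr_le0.
  apply: (nonpos_of_profile (ancient_solutionN us) p_gt1 e_gt0 Q_gt0 mu_gt0
    cG muG superG GQ) => //.
  move=> y s y_neq0 s_le0; rewrite -phi_inftyE.
  by apply: le_trans (ler_norm _) _; rewrite normrN; exact: u_bound.
Qed.
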